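(* Let $d\ge 2$ and let $\varphi=\sum_{i=0}^{d-1}\alpha_i e_i\otimes e_i\in\mathbb{C}^d\otimes\mathbb{C}^d$, where $\alpha_0\ge\cdots\ge\alpha_{d-1}>0$ and $\sum_{i=0}^{d-1}\alpha_i^2=1$. Suppose that $\mathcal{M}\subseteq\mathcal{B}(\mathcal{H})$ is a non-degenerate von Neumann algebra and that $\psi\in\mathcal{H}$ is a unit vector. Let $R\in M_d\otimes\mathcal{M}$ be a contraction. The following are equivalent: (1) $(R,\psi)$ exactly embezzles $\varphi$ in $(\mathcal{M},\mathcal{H})$ (monopartite). (2) There is a contraction $T\in\mathcal{M}'\otimes M_d$ for which $(R,T,\psi)$ exactly embezzles $\varphi$ in $(\mathcal{M},\mathcal{M}',\mathcal{H})$ (bipartite).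
   Context: $\{e_0,\dots,e_{d-1}\}$ is the canonical orthonormal basis of $\mathbb{C}^d$; $\mathcal{M}'$ is the commutant; inner products are linear in the first variable. Write $R=\sum_{i,j=0}^{d-1}E_{ij}\otimes R_{ij}$ with $R_{ij}\in\mathcal{M}$, $E_{ij}$ the matrix units of $M_d$. Monopartite: $(R,\psi)$ exactly embezzles $\varphi$ in $(\mathcal{M},\mathcal{H})$ if $R\in M_d\otimes\mathcal{M}$ is a contraction, $\psi\in\mathcal{H}$ is a unit vector and, with $\omega=\langle(\cdot)\psi,\psi\rangle$ on $\mathcal{M}$, $\omega(R_{i0}^*XR_{j0})=\delta_{ij}\alpha_i^2\omega(X)$ for all $X\in\mathcal{M}$ and $i,j=0,\dots,d-1$. Bipartite: $(R,T,\psi)$ exactly embezzles $\varphi$ in $(\mathcal{M},\mathcal{M}',\mathcal{H})$ if $R\in M_d\otimes\mathcal{M}$ (acting on $\mathbb{C}^d\otimes\mathcal{H}$) and $T\in\mathcal{M}'\otimes M_d$ (acting on $\mathcal{H}\otimes\mathbb{C}^d$) are contractions, $\psi\in\mathcal{H}$ is a unit vector, and $(R\otimes I_d)(I_d\otimes T)(e_0\otimes\psi\otimes e_0)=\sum_{i=0}^{d-1}\alpha_i\,e_i\otimes\psi\otimes e_i$. *)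

(* Defs.v *)
From HB Require Import structures.
From mathcomp Require Import all_boot all_order all_algebra.
From mathcomp Require Import sesquilinear.
From mathcomp Require Import complex.
From mathcomp Require Import all_classical all_reals all_analysis.
Import Order.TTheory GRing.Theory Num.Theory.
Import numFieldNormedType.Exports.

Set Implicit Arguments.
Unset Strict Implicit.
Unset Printing Implicit Defensive.

Local Open Scope classical_set_scope.
Local Open Scope ring_scope.
Local Open Scope complex_scope.

(* [{dot H for Num.conj}] is linear in the first variable and conjugate-linear
   in the second. *)
HB.mixin Record CompleteNormedModule_isHilbert (R : realType) H
    & CompleteNormedModule R[i] H := {
  inner : {dot H for Num.conj : R[i] -> R[i]} ;
  inner_norm : forall x : H, inner x x = `|x| ^+ 2 }.

#[short(type="hilbertType")]
HB.structure Definition Hilbert (R : realType) :=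
  { H of CompleteNormedModule R[i] H & CompleteNormedModule_isHilbert R H }.

Section BoundedOperators.
Variables (R : realType) (H : hilbertType R).

Definition bounded_operator : {pred H -> H} :=
  mem [set f : H -> H | linear f /\ continuous f].

Record bop := Bop { bop_fun :> H -> H; _ : bop_fun \in bounded_operator }.

HB.instance Definition _ := [isSub for bop_fun].
HB.instance Definition _ := [Choice of bop by <:].

Lemma bounded_operator_submod : submod_closed bounded_operator.
Proof.
split.
  by rewrite inE; split; [move=> a x y; rewrite scaler0 addr0
                          |exact: cst_continuous].
move=> a f g; rewrite !inE => -[lf cf] [lg cg]; split.
  move=> b x y; rewrite !fctE /= lf lg !scalerDr !scalerA [a * b]mulrC.
  by rewrite addrACA.
by move=> x; apply: cvgD; [apply: cvgZr; exact: cf|exact: cg].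
Qed.

HB.instance Definition _ :=
  GRing.isSubmodClosed.Build R[i] (H -> H) bounded_operator
    bounded_operator_submod.
HB.instance Definition _ := [SubChoice_isSubLmodule of bop by <:].

Lemma bop_linear (A : bop) : linear A.
Proof. by case: A => f /= /[!inE] -[]. Qed.

Lemma bop_continuous (A : bop) : continuous A.
Proof. by case: A => f /= /[!inE] -[]. Qed.

HB.instance Definition _ (A : bop) :=
  GRing.isLinear.Build R[i] H H *:%R A (@bop_linear A).

Lemma bop_comp_subproof (A B : bop) : A \o B \in bounded_operator.
Proof.
rewrite inE; split; first by move=> a x y /=; rewrite !linearP.
by move=> x; apply: continuous_comp; exact: bop_continuous.
Qed.

Definition bop_comp (A B : bop) : bop := Bop (bop_comp_subproof A B).

(* By the Riesz representation theorem the set below is always a singleton, so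
   the default value 0 is never used. *)
Definition adjoint (A : bop) : bop :=
  xget 0 [set B : bop | forall x y, inner (A x) y = inner x (B y)].

End BoundedOperators.

Section VonNeumann.
Variables (R : realType) (H : hilbertType R).
Implicit Type M : set (bop H).

Definition commutant M : set (bop H) :=
  [set A | forall B, M B -> bop_comp A B = bop_comp B A].

(* The coarsest topology on B(H) making every A |-> <A x, y> continuous. *)
Definition weak_operator_topology : Type :=
  initial_topology
    (fun A : bop H => (fun p => inner (A p.1) p.2) : {ptws H * H -> R[i]^o}).

HB.instance Definition _ := Topological.on weak_operator_topology.

(* M is not assumed to contain the identity. *)
Record von_neumann_algebra M : Prop := VonNeumannAlgebra {
  vna_0 : M 0 ;
  vna_add : forall A B, M A -> M B -> M (A + B) ;
  vna_scale : forall (a : R[i]) A, M A -> M (a *: A) ;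
  vna_mul : forall A B, M A -> M B -> M (bop_comp A B) ;
  vna_adjoint : forall A, M A -> M (adjoint A) ;
  vna_closed : closed (M : set weak_operator_topology) }.

(* The linear span of the vectors A x, for A in M and x in H, is dense. *)
Definition nondegenerate_algebra M :=
  dense [set y : H | exists n (A : 'I_n -> bop H) (x : 'I_n -> H),
    (forall k, M (A k)) /\ y = \sum_(k < n) A k (x k)].

End VonNeumann.

(* C^d (x) H and H (x) C^d are both modelled by the l2 direct sum of d copies of
   H, with e_i (x) v and v (x) e_i the vector v in position i.  Likewise
   C^d (x) H (x) C^d is modelled by families w of vectors of H indexed by pairs,
   w standing for the sum of the e_i (x) w (i, j) (x) e_j.  An element
   sum_{i,j} E_ij (x) A_ij of M_d (x) B(H), or sum_{i,j} A_ij (x) E_ij of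
   B(H) (x) M_d, is the matrix of the A_ij. *)
Section OperatorMatrices.
Variables (R : realType) (H : hilbertType R) (d : nat).
Implicit Types (A : 'M[bop H]_d) (M : set (bop H)).

Definition matrices_over M : set 'M[bop H]_d := [set A | forall i j, M (A i j)].

Definition opmx_act A (v : {ffun 'I_d -> H}) : {ffun 'I_d -> H} :=
  [ffun i => \sum_(j < d) A i j (v j)].

Definition l2norm (v : {ffun 'I_d -> H}) : R[i] :=
  sqrtC (\sum_(i < d) `|v i| ^+ 2).

Definition op_contraction A := forall v, l2norm (opmx_act A v) <= l2norm v.

Definition tensor3 (i : 'I_d) (v : H) (j : 'I_d) : {ffun 'I_d * 'I_d -> H} :=
  [ffun p => if p == (i, j) then v else 0].

(* A (x) I_d, for A in M_d (x) B(H). *)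
Definition ampl_right A (w : {ffun 'I_d * 'I_d -> H}) :
    {ffun 'I_d * 'I_d -> H} :=
  [ffun p => \sum_(k < d) A p.1 k (w (k, p.2))].

(* I_d (x) A, for A in B(H) (x) M_d. *)
Definition ampl_left A (w : {ffun 'I_d * 'I_d -> H}) :
    {ffun 'I_d * 'I_d -> H} :=
  [ffun p => \sum_(k < d) A p.2 k (w (p.1, k))].

End OperatorMatrices.

Definition idx0 (d : nat) (hd : (2 <= d)%N) : 'I_d := Ordinal (ltnW hd).

Section Embezzlement.
Variables (R : realType) (H : hilbertType R) (d : nat) (hd : (2 <= d)%N).
Local Notation o := (idx0 hd).

(* The vector to embezzle is phi = sum_i alpha_i e_i (x) e_i, given by alpha. *)
Variable alpha : 'I_d -> R.

Definition vector_functional (psi : H) (X : bop H) : R[i] := inner (X psi) psi.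

Record monopartite_embezzles (M : set (bop H)) (A : 'M[bop H]_d) (psi : H) :
    Prop := MonopartiteEmbezzles {
  mono_in : matrices_over M A ;
  mono_contraction : op_contraction A ;
  mono_unit : `|psi| = 1 ;
  mono_eq : forall X, M X -> forall i j : 'I_d,
    vector_functional psi (bop_comp (adjoint (A i o)) (bop_comp X (A j o))) =
    (i == j)%:R * (alpha i ^+ 2)%:C * vector_functional psi X }.

Record bipartite_embezzles (M : set (bop H)) (A B : 'M[bop H]_d) (psi : H) :
    Prop := BipartiteEmbezzles {
  bi_inl : matrices_over M A ;
  bi_inr : matrices_over (commutant M) B ;
  bi_contractionl : op_contraction A ;
  bi_contractionr : op_contraction B ;
  bi_unit : `|psi| = 1 ;
  bi_eq : ampl_right A (ampl_left B (tensor3 o psi o)) =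
    \sum_(i < d) (alpha i)%:C *: tensor3 i psi i }.

End Embezzlement.

(* Main.v *)
(* Let a_i be the first column of R, so that the monopartite condition reads
   <X a_j psi, a_i psi> = delta_ij alpha_i^2 <X psi, psi> for X in M.

   Suppose that it holds. Then X psi |-> alpha_i^-1 X a_i psi extends to a
   partial isometry V_i from [M psi] to [M a_i psi] ([ ] denoting closures); these lie in M' and have
   mutually orthogonal ranges. The adjoints b_i of the V_i therefore form a
   column contraction over M' with b_j a_i psi = delta_ij alpha_i psi, because
   psi lies in [M psi] by nondegeneracy, and T is the matrix having this column
   and zeros elsewhere.

   Conversely, let b_i be the first column of T. Then
   b_j a_i psi = a_i b_j psi = delta_ij alpha_i psi, and
   sum_i alpha_i^2 = 1 forces the contraction (b_j) to preserve the norm of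
   each a_i psi, hence also its inner product with every vector:
   <X a_j psi, a_i psi> = sum_k <b_k X a_j psi, b_k a_i psi>, where only k = i
   contributes. *)

Require Import Defs.
From HB Require Import structures.
From mathcomp Require Import all_boot all_order all_algebra sesquilinear.
From mathcomp Require Import complex ring lra.
From mathcomp Require Import all_classical all_reals all_analysis.
Import Order.TTheory GRing.Theory Num.Theory.
Import numFieldNormedType.Exports.
Local Open Scope classical_set_scope.
Local Open Scope ring_scope.
Local Open Scope complex_scope.
Set Implicit Arguments.
Unset Strict Implicit.
Unset Printing Implicit Defensive.

(** Taking [t] to be [- s] times the conjugate of [c], with [s] real, turns the hypothesis into a
    real quadratic inequality in [s]. It serves for Cauchy-Schwarz, for almost minimisers in the
    Riesz argument and for column contractions. *)
Lemma quadratic_discriminant (C : numClosedFieldType) (e n c : C) :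
  0 <= e -> 0 <= n ->
  (forall t, 0 <= e + (t * c + (t * c)^*%R) + `|t| ^+ 2 * n) ->
  `|c| ^+ 2 <= e * n.
Proof.
move=> e0 n0 q.
have [->|cN0] := eqVneq c 0; first by rewrite normr0 expr0n mulr_ge0.
have cc : c^*%R * c = `|c| ^+ 2 by rewrite normCK mulrC.
have pc : 0 < `|c| ^+ 2 by rewrite exprn_gt0 ?normr_gt0.
have key s : s \is Num.real ->
    0 <= e - s * `|c| ^+ 2 *+ 2 + s ^+ 2 * `|c| ^+ 2 * n.
  move=> sr; have := q (- s * c^*%R).
  have -> : - s * c^*%R * c = - s * `|c| ^+ 2 by rewrite -mulrA cc.
  have -> : (- s * `|c| ^+ 2)^*%R = - s * `|c| ^+ 2.
    by apply/CrealP; rewrite rpredM ?rpredN ?rpredX ?normr_real.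
  rewrite -mulr2n mulNr mulNrn.
  rewrite normrM normrN norm_conjC exprMn (real_normK sr); apply.
have [n00|nN0] := eqVneq n 0; last first.
  have np : 0 < n by rewrite lt_def nN0.
  (* The quadratic in [s] is minimal at [n^-1]. *)
  have := key n^-1; rewrite realV ger0_real // => /(_ isT).
  have -> : n^-1 ^+ 2 * `|c| ^+ 2 * n = n^-1 * `|c| ^+ 2.
    by rewrite mulrAC expr2 -[_ * _ * n]mulrA mulVf // mulr1.
  rewrite mulr2n opprD addrA subrK subr_ge0.
  by rewrite ler_pdivrMl // mulrC.
(* For [n = 0] the expression is affine in [s], and this [s] brings it down to [- (e + 2)]. *)
have := key ((e + 1) / `|c| ^+ 2).
rewrite realM ?realV ?realD ?ger0_real ?exprn_ge0 ?ler01 // => /(_ isT).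
rewrite n00 mulr0 addr0 divfK ?gt_eqF //.
have -> : e - (e + 1) *+ 2 = - (e + 2) by ring.
by rewrite oppr_ge0 lt_geF // ltr_wpDl.
Qed.

(** * Inner products and the Cauchy-Schwarz inequality *)

Section InnerProduct.
Variables (R : realType) (H : hilbertType R).
Implicit Types u v w : H.

Lemma innerC u v : inner u v = (inner v u)^*%R.
Proof. by rewrite hermC expr0 mul1r. Qed.

Lemma innerDl u v w : inner (u + v) w = inner u w + inner v w.
Proof. exact: linearDl. Qed.

Lemma innerDr u v w : inner w (u + v) = inner w u + inner w v.
Proof. exact: linearDr. Qed.

Lemma innerBl u v w : inner (u - v) w = inner u w - inner v w.
Proof. exact: linearBl. Qed.

Lemma innerBr u v w : inner w (u - v) = inner w u - inner w v.
Proof. exact: linearBr. Qed.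

Lemma innerZl a u w : inner (a *: u) w = a * inner u w.
Proof. exact: linearZl_LR. Qed.

Lemma innerZr a u w : inner w (a *: u) = a^*%R * inner w u.
Proof. exact: linearZr_LR. Qed.

Lemma inner0l w : inner 0 w = 0 :> R[i].
Proof. exact: linear0l. Qed.

Lemma inner0r w : inner w 0 = 0 :> R[i].
Proof. exact: linear0r. Qed.

Lemma inner_suml (I : finType) (F : I -> H) w :
  inner (\sum_i F i) w = \sum_i inner (F i) w.
Proof. exact: linear_sumlz. Qed.

Lemma inner_sumr (I : finType) (F : I -> H) w :
  inner w (\sum_i F i) = \sum_i inner w (F i).
Proof. exact: linear_sumr. Qed.

Lemma inner_eq0 u : inner u u = 0 -> u = 0.
Proof.
by rewrite inner_norm => /eqP; rewrite expf_eq0 /= normr_eq0 => /eqP.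
Qed.

Lemma inner_ext u v : (forall w, inner w u = inner w v) -> u = v.
Proof.
by move=> uv; apply/subr0_eq/inner_eq0; rewrite innerBr uv subrr.
Qed.

Lemma Cauchy_Schwarz_inner u v : `|inner u v| <= `|u| * `|v|.
Proof.
rewrite -(@ler_pXn2r _ 2) ?nnegrE ?mulr_ge0 // exprMn.
apply: quadratic_discriminant; rewrite ?exprn_ge0 // => t.
rewrite -!inner_norm.
(* The conjugate of [t] makes up for conjugate-linearity in the second variable. *)
have -> : inner u u + (t * inner u v + (t * inner u v)^*%R) +
   `|t| ^+ 2 * inner v v = inner (u + t^*%R *: v) (u + t^*%R *: v).
  rewrite !(innerDl, innerDr, innerZl, innerZr) conjCK normCK.
  by rewrite (innerC v u) rmorphM /=; ring.
by rewrite inner_norm exprn_ge0.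
Qed.

Lemma eq0_small (x K : R[i]) :
  0 <= K -> (forall e, 0 < e -> `|x| <= e * K) -> x = 0.
Proof.
move=> K0 h; apply/eqP; rewrite -normr_le0.
apply/ler_addgt0Pr => e e0; rewrite add0r.
have K1 : 0 < K + 1 by rewrite ltr_wpDl.
apply: le_trans (h (e / (K + 1)) _) _; first by rewrite divr_gt0.
by rewrite mulrAC ler_pdivrMr // ler_wpM2l ?ltW // ltrDl.
Qed.

Lemma sqr_le_cancel (a b : R[i]) :
  0 <= a -> 0 <= b -> a ^+ 2 <= b * a -> a <= b.
Proof.
move=> a0 b0; have [->//|aN0] := eqVneq a 0.
by rewrite expr2 ler_pM2r // lt_def aN0.
Qed.

(** * Riesz representation along a linear map *)

Section Riesz.
(** The functional lives on a parameter space: for [S = M] and [T X = X psi], that [f X] depends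
    only on [X psi] is already a consequence of [f_bound]. The classical theorem is the case
    [S = setT], [T = id]. *)
Variables (V : lmodType R[i]) (S : set V) (T : V -> H) (f : V -> R[i]).
Hypothesis S0 : S 0.
Hypothesis SP : forall (a : R[i]) x y, S x -> S y -> S (a *: x + y).
Hypothesis T_lin : forall a x y, T (a *: x + y) = a *: T x + T y.
Hypothesis f_lin : forall a x y, f (a *: x + y) = a * f x + f y.
Variable K : R.
Hypothesis K_ge0 : 0 <= K.
Hypothesis f_bound : forall x, S x -> `|f x| <= K%:C * `|T x|.

(* Almost minimisers of [J] are Cauchy after applying [T], and their limit
   represents [f]. *)
Let J x : R[i] := `|T x| ^+ 2 - (f x + (f x)^*%R).

Lemma energy_real x : J x \is Num.real.
Proof.
rewrite /J rpredB ?rpredX ?normr_real //.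
by apply/CrealP; rewrite rmorphD /= conjCK addrC.
Qed.

(** Completing the square: with [t = |T x|], the energy is at least
    [t^2 - 2 K t = (t - K)^2 - K^2]. *)
Lemma energy_lower_bound x : S x -> - K ^+ 2 <= complex.Re (J x).
Proof.
move=> Sx; have := f_bound Sx.
have [t tE] : exists t : R, `|T x| = t%:C.
  by apply/complex_realP; rewrite normr_real.
have t0 : 0 <= t by rewrite -ler0c -tE.
rewrite /J tE -rmorphM => fx.
have : `|complex.Re (f x)| <= K * t.
  by rewrite -lecR; apply: le_trans fx; exact: normc_ge_Re.
rewrite ler_norml => /andP[_ fK].
have -> : f x + (f x)^*%R = (complex.Re (f x) *+ 2)%:C.
  by rewrite addcJ rmorphMn mulr_natl.
rewrite -rmorphXn -rmorphB /=.
have := sqr_ge0 (t - K); nra.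
Qed.

Lemma energy_almost_min (e : R[i]) : 0 < e ->
  exists2 u, S u & forall x, S x -> J u <= J x + e.
Proof.
move=> e0; have eE : (complex.Re e)%:C = e by rewrite RRe_real // gtr0_real.
have Re0 : 0 < complex.Re e by rewrite -ltcR eE.
pose E := [set complex.Re (J x) | x in S].
have iE : has_inf E.
  split; first by exists (complex.Re (J 0)), 0.
  by exists (- K ^+ 2) => _ [x Sx <-]; exact: energy_lower_bound.
have [_ [u Su <-] ue] := inf_adherent Re0 iE.
exists u => // x Sx.
rewrite -(RRe_real (energy_real u)) -(RRe_real (energy_real x)) -eE.
rewrite -rmorphD lecR (le_trans (ltW ue)) // lerD2r.
by apply: ge_inf; [exact: iE.2|exists x].
Qed.

(** An approximate Euler-Lagrange equation: if [u] minimises [J] up to [e^2], then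
    [J (t x + u) - J u + e^2] is nonnegative for all [t], and its linear coefficient
    [<T x, T u> - f x] is bounded by the discriminant. *)
Lemma Riesz_approx (e : R[i]) : 0 < e ->
  exists2 u, S u & forall x, S x -> `|inner (T x) (T u) - f x| <= e * `|T x|.
Proof.
move=> e0; have [u Su umin] := energy_almost_min (exprn_gt0 2 e0).
exists u => // x Sx.
have {}e0 := ltW e0.
rewrite -(@ler_pXn2r _ 2) ?nnegrE ?mulr_ge0 // exprMn.
apply: quadratic_discriminant; rewrite ?exprn_ge0 // => t.
have := umin _ (SP t Sx Su); rewrite -subr_ge0; congr (_ <= _).
rewrite /J T_lin f_lin -!inner_norm.
rewrite !(innerDl, innerDr, innerZl, innerZr) normCK.
rewrite (innerC (T u)) !(rmorphM, rmorphD, rmorphB) /=.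
by ring.
Qed.

(* [T @` S] need not be closed: the second clause places [z] in its closure. *)
Lemma Riesz : exists z,
  [/\ forall x, S x -> f x = inner (T x) z,
      forall w, (forall x, S x -> inner (T x) w = 0) -> inner z w = 0
    & `|z| <= K%:C].
Proof.
have : forall n : nat, exists u : V, S u /\ forall x, S x ->
    `|inner (T x) (T u) - f x| <= n.+1%:R^-1 * `|T x|.
  move=> n; have /Riesz_approx[u Su uP] : 0 < n.+1%:R^-1 :> R[i].
    by rewrite invr_gt0.
  by exists u.
move=> /choice[u uP].
have Tlim : exists z, forall e, 0 < e ->
    exists n, [/\ n.+1%:R^-1 <= e & `|z - T (u n)| <= e].
  have near_inv e : 0 < e -> \forall n \near \oo, n.+1%:R^-1 <= e :> R[i].
    move=> e0; have eE : (complex.Re e)%:C = e by rewrite RRe_real // gtr0_real.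
    have Re0 : 0 < complex.Re e by rewrite -ltcR eE.
    near=> n; rewrite -eE -(rmorph_nat (real_complex R)) -fmorphV lecR ltW //.
    by near: n; exact: (near_infty_natSinv_lt (PosNum Re0)).
  (* Both approximate equations are tested at [u n - u m]: the value of [f] cancels, and one factor
     of the norm is divided out. *)
  have uu n m : `|T (u n) - T (u m)| <= n.+1%:R^-1 + m.+1%:R^-1 :> R[i].
    have [->|x0] := eqVneq (T (u n) - T (u m)) 0.
      by rewrite normr0 addr_ge0.
    have Sx : S (- 1 *: u m + u n) by apply: SP; [exact: (uP m).1|exact: (uP n).1].
    have Tx : T (- 1 *: u m + u n) = T (u n) - T (u m).
      by rewrite T_lin scaleN1r addrC.
    rewrite -(@ler_pM2r _ `|T (u n) - T (u m)|) ?normr_gt0 // -expr2.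
    rewrite -[`|_ - _| ^+ 2]ger0_norm ?exprn_ge0 // -inner_norm innerBr -Tx.
    rewrite -(subrKA (f (- 1 *: u m + u n))) -[X in _ + X]opprB.
    rewrite mulrDl (le_trans (ler_normB _ _)) // lerD //; [exact: (uP n).2|].
    by apply: (uP m).2.
  have /cauchy_cvg/cvg_ex[z uz] : cauchy (T (u n) @[n --> \oo]).
    apply/cauchy_ballP => e e0; near_simpl.
    have e4 : 0 < e / 4 by rewrite divr_gt0.
    near=> n m => /=; rewrite -ball_normE /=.
    have le : e / 4 + e / 4 < e.
      by rewrite -mulrDl ltr_pdivrMr // -mulr2n -[e *+ 2]mulr_natr
        ltr_pM2l // ltr_nat.
    apply: le_lt_trans (uu _ _) (le_lt_trans (lerD _ _) le).
      by near: n; exact: near_inv.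
    by near: m; exact: near_inv.
  exists z => e e0.
  near \oo => n; exists n; split; first by near: n; exact: near_inv.
  by near: n; move/cvgrPdist_le : uz; exact.
case: Tlim => z zP.
have zE x : S x -> f x = inner (T x) z.
  move=> Sx; apply/esym/subr0_eq.
  apply: (@eq0_small _ (`|T x| *+ 2)) => [|e e0]; first by rewrite mulrn_wge0.
  have [n [ne zn]] := zP e e0.
  have -> : inner (T x) z - f x =
      inner (T x) (z - T (u n)) + (inner (T x) (T (u n)) - f x).
    by rewrite innerBr; ring.
  rewrite mulr2n mulrDr (le_trans (ler_normD _ _)) // lerD //.
    by rewrite (le_trans (Cauchy_Schwarz_inner _ _)) // mulrC ler_wpM2r.
  by rewrite (le_trans ((uP n).2 _ Sx)) // ler_wpM2r.
exists z; split=> [//|w w0|].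
  apply: (@eq0_small _ `|w|) => // e e0.
  have [n [_ zn]] := zP e e0.
  rewrite -[inner z w]subr0 -(w0 _ (uP n).1) -innerBl.
  by rewrite (le_trans (Cauchy_Schwarz_inner _ _)) // ler_wpM2r.
(* Since [<T (u n), z> = f (u n)], splitting [z] as [T (u n) + (z - T (u n))] shows that [|z|^2]
   exceeds [K |z|] by at most [|z - T (u n)| (|z| + K)], which can be made arbitrarily small. *)
have K0 : 0 <= K%:C by rewrite ler0c.
apply: sqr_le_cancel => //; apply/ler_addgt0Pr => e e0.
have zK : 0 < `|z| + K%:C + 1 by rewrite ltr_wpDl // addr_ge0.
have [n [_ zn]] := zP (e / (`|z| + K%:C + 1)) (divr_gt0 e0 zK).
have {}zn : `|z - T (u n)| * (`|z| + K%:C) <= e.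
  apply: le_trans (ler_wpM2r _ zn) _; first by rewrite addr_ge0.
  by rewrite mulrAC ler_pdivrMr // ler_wpM2l ?ltW // ltrDl.
rewrite -inner_norm -[X in inner X _](subrK (T (u n))) innerDl.
rewrite -[leLHS]ger0_norm; last by rewrite -innerDl subrK inner_norm exprn_ge0.
rewrite -zE; last exact: (uP n).1.
rewrite (le_trans (ler_normD _ _)) // addrC.
apply: le_trans (lerD (f_bound (uP n).1) (Cauchy_Schwarz_inner _ _)) _.
apply: le_trans (lerD (lexx _) zn); rewrite mulrDr.
rewrite [X in _ <= _ + X]addrC addrA lerD2r [_ * K%:C]mulrC -mulrDr ler_wpM2l //.
by rewrite -[X in `|X| <= _](subKr z) ler_normB.
Unshelve. all: by end_near. Qed.
End Riesz.
End InnerProduct.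

(** * Bounded operators and adjoints *)

Section Operators.
Variables (R : realType) (H : hilbertType R).
Implicit Types (A B X Y : bop H) (u v w x y z : H).

Lemma bop_eqP A B : (forall x, A x = B x) -> A = B.
Proof. by move=> AB; apply/val_inj/funext. Qed.

Lemma bopZ A a x : A (a *: x) = a *: A x.
Proof. exact: linearZ. Qed.

Lemma bop_bounded A : exists2 c : R, 0 <= c & forall x, `|A x| <= c%:C * `|x|.
Proof.
have /linear_bounded_continuous/linear_boundedP := @bop_continuous _ _ A.
move=> /pinfty_ex_gt0[r r0 rA].
have rE : (complex.Re r)%:C = r by rewrite RRe_real // gtr0_real.
by exists (complex.Re r); [rewrite -ler0c rE ltW|rewrite rE].
Qed.

Lemma bounded_linear_bop (f : H -> H) (c : R) :
  linear f -> (forall x, `|f x| <= c%:C * `|x|) -> exists A, A =1 f.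
Proof.
move=> lf bf; have fb : f \in @bounded_operator R H.
  rewrite inE; split => //.
  pose g := HB.pack_for {linear H -> H} f (GRing.isLinear.Build _ _ _ _ f lf).
  apply: (@linear_bounded_continuous _ _ _ g).1.
  apply/linear_boundedP; near=> r => x.
  rewrite (le_trans (bf x)) // ler_wpM2r //.
  by near: r; apply: nbhs_pinfty_ge; rewrite complex_real.
by exists (Bop fb).
Unshelve. all: by end_near. Qed.

(** Riesz representation of [x |-> <A x, y>] for each [y]; uniqueness of the representing vector
    makes it linear in [y], and the norm estimate makes it bounded. *)
Lemma adjoint_exists A : exists B, forall x y, inner (A x) y = inner x (B y).
Proof.
have [c c0 cA] := bop_bounded A.
have rep y : exists z,
    (forall x, inner (A x) y = inner x z) /\ `|z| <= c%:C * `|y|.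
  have [y' y'E] : exists t : R, `|y| = t%:C.
    by apply/complex_realP; rewrite normr_real.
  have y'0 : 0 <= y' by rewrite -ler0c -y'E.
  have lin a u v : inner (A (a *: u + v)) y = a * inner (A u) y + inner (A v) y.
    by rewrite linearP innerDl innerZl.
  have bound x : setT x -> `|inner (A x) y| <= (c * y')%:C * `|x|.
    move=> _; rewrite (le_trans (Cauchy_Schwarz_inner _ _)) //.
    by rewrite rmorphM /= -y'E mulrAC ler_wpM2r.
  have [z [zE _ zy]] := @Riesz _ _ H setT id _ I (fun _ _ _ _ _ => I)
    (fun _ _ _ => erefl) lin _ (mulr_ge0 c0 y'0) bound.
  by exists z; split=> [x|]; [exact: zE|rewrite y'E -rmorphM].
have [g gP] := choice rep.
have [a u v|y|B BE] := @bounded_linear_bop g c.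
- apply: inner_ext => w; rewrite innerDr innerZr -!(gP _).1.
  by rewrite innerDr innerZr.
- exact: (gP y).2.
- by exists B => x y; rewrite BE (gP y).1.
Qed.

Lemma adjointP A x y : inner (A x) y = inner x (adjoint A y).
Proof.
(* Existence excludes the default value of [xget]. *)
by rewrite /adjoint; case: xgetP => [B _ BP|/(_ _) noB] //;
  have [B /noB] := adjoint_exists A.
Qed.

Lemma adjointPl A x y : inner (adjoint A x) y = inner x (A y).
Proof. by rewrite innerC -adjointP -innerC. Qed.

End Operators.

(** * Column contractions and the bipartite equation in coordinates *)

Section Columns.
Variables (R : realType) (H : hilbertType R) (d : nat) (hd : (2 <= d)%N).
Local Notation o := (idx0 hd).

Definition column_contraction (b : 'I_d -> bop H) :=
  forall v, \sum_i `|b i v| ^+ 2 <= `|v| ^+ 2.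

Lemma sum_sqr_norm_ge0 (v : {ffun 'I_d -> H}) : 0 <= \sum_i `|v i| ^+ 2 :> R[i].
Proof. by apply: sumr_ge0 => i _; rewrite exprn_ge0. Qed.

Lemma op_contraction_column (A : 'M[bop H]_d) :
  op_contraction A -> column_contraction (fun i => A i o).
Proof.
move=> cA v; have := cA [ffun j => if j == o then v else 0].
rewrite /l2norm ler_sqrtC ?nnegrE ?sum_sqr_norm_ge0 //.
rewrite [leRHS](bigD1 o) //= ffunE eqxx [X in _ + X]big1 ?addr0; last first.
  by move=> j /negPf jo; rewrite ffunE jo normr0 expr0n.
congr (_ <= _); apply: eq_bigr => i _; congr (`|_| ^+ 2).
rewrite ffunE (bigD1 o) //= ffunE eqxx big1 ?addr0 // => j /negPf jo.
by rewrite ffunE jo linear0.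
Qed.

Lemma column_op_contraction (b : 'I_d -> bop H) : column_contraction b ->
  op_contraction (\matrix_(i, j) if j == o then b i else 0).
Proof.
move=> cb v; rewrite /l2norm ler_sqrtC ?nnegrE ?sum_sqr_norm_ge0 //.
rewrite (le_trans _ (_ : `|v o| ^+ 2 <= _)) //; last first.
  by rewrite [leRHS](bigD1 o) //= lerDl sumr_ge0 // => i _; rewrite exprn_ge0.
rewrite (le_trans _ (cb (v o))) // le_eqVlt; apply/orP; left; apply/eqP.
apply: eq_bigr => i _; congr (`|_| ^+ 2).
rewrite ffunE (bigD1 o) //= mxE eqxx big1 ?addr0 // => j /negPf jo.
by rewrite mxE jo.
Qed.

(* A positive semidefinite form vanishing on the diagonal at [x] vanishes
   against [x]. *)
Lemma column_contraction_polar (b : 'I_d -> bop H) x :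
  column_contraction b -> `|x| ^+ 2 <= \sum_i `|b i x| ^+ 2 ->
  forall w, inner w x = \sum_i inner (b i w) (b i x).
Proof.
move=> cb bx w; apply/subr0_eq.
set c := (X in X = 0).
have e0 : `|x| ^+ 2 - \sum_i `|b i x| ^+ 2 = 0.
  by apply/eqP; rewrite subr_eq0 eq_le bx cb.
suff : `|c| ^+ 2 <= 0 * (`|w| ^+ 2 - \sum_i `|b i w| ^+ 2).
  rewrite mul0r => c0; apply/eqP; rewrite -normr_eq0 -sqrf_eq0.
  by rewrite eq_le c0 exprn_ge0.
apply: quadratic_discriminant => [//||t]; first by rewrite subr_ge0 cb.
have := cb (t *: w + x); rewrite -subr_ge0; congr (0 <= _).
rewrite -[RHS]addr0 -[X in _ = _ + X]e0.
have sq (y z : H) : `|t *: y + z| ^+ 2 = `|z| ^+ 2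
    + (t * inner y z + (t * inner y z)^*%R) + `|t| ^+ 2 * `|y| ^+ 2.
  rewrite -!inner_norm !(innerDl, innerDr, innerZl, innerZr).
  by rewrite normCK (innerC z) rmorphM /=; ring.
under eq_bigr => i _ do rewrite (linearP (b i)) sq.
rewrite sq !big_split /= -!mulr_sumr -rmorph_sum /= -mulr_sumr.
rewrite /c mulrBr rmorphB /=.
by ring.
Qed.

(** The vector [tensor3 o psi o] is supported at position [(o, o)], so only the first columns of [A]
    and [B] contribute to the coordinates. *)
Lemma bipartite_eqP (alpha : 'I_d -> R) (A B : 'M[bop H]_d) psi :
  ampl_right A (ampl_left B (tensor3 o psi o)) =
    \sum_(i < d) (alpha i)%:C *: tensor3 i psi i <->
  forall i j, A i o (B j o psi) = if i == j then (alpha i)%:C *: psi else 0.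
Proof.
have lE i j : ampl_right A (ampl_left B (tensor3 o psi o)) (i, j) =
    A i o (B j o psi).
  rewrite ffunE (bigD1 o) //= [X in _ + X]big1 ?addr0 => [|k /negPf ko]; last first.
    rewrite ffunE big1 ?linear0 // => l _.
    by rewrite ffunE xpair_eqE /= ko linear0.
  rewrite ffunE (bigD1 o) //= [X in _ + X]big1 ?addr0 => [|k /negPf ko]; last first.
    by rewrite ffunE xpair_eqE eqxx /= ko linear0.
  by rewrite ffunE eqxx.
have rE i j : (\sum_(k < d) (alpha k)%:C *: tensor3 k psi k) (i, j) =
    if i == j then (alpha i)%:C *: psi else 0.
  rewrite sum_ffunE (bigD1 i) //= big1 ?addr0 => [|k /negPf ki].
    rewrite !ffunE xpair_eqE eqxx /= [j == i]eq_sym.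
    by case: eqP => //; rewrite scaler0.
  by rewrite !ffunE xpair_eqE [i == k]eq_sym ki scaler0.
split=> [e i j|e]; first by rewrite -lE e rE.
by apply/ffunP => -[i j]; rewrite lE rE e.
Qed.
End Columns.

(** * From bipartite to monopartite embezzlement *)

Section Embezzlement.
Variables (R : realType) (H : hilbertType R) (d : nat) (hd : (2 <= d)%N).
Local Notation o := (idx0 hd).
Variable alpha : 'I_d -> R.
Hypothesis alpha_gt0 : forall i, 0 < alpha i.
Hypothesis alpha_sum : \sum_(i < d) alpha i ^+ 2 = 1.
Variable M : set (bop H).
Variables (psi : H) (A : 'M[bop H]_d).
Hypothesis psi_unit : `|psi| = 1.
Hypothesis A_M : matrices_over M A.
Hypothesis A_contr : op_contraction A.

Lemma monopartite_of_bipartite B :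
  bipartite_embezzles hd alpha M A B psi ->
  monopartite_embezzles hd alpha M A psi.
Proof.
move=> [_ B_M' _ B_contr _ /bipartite_eqP e].
have ca := op_contraction_column hd A_contr.
have cb := op_contraction_column hd B_contr.
have comm X j v : M X -> B j o (X v) = X (B j o v).
  by move=> MX; have := congr1 (fun Z : bop H => Z v) (B_M' j o X MX).
have eB i j : B j o (A i o psi) = if i == j then (alpha i)%:C *: psi else 0.
  by rewrite comm.
have sumB i : \sum_j `|B j o (A i o psi)| ^+ 2 = (alpha i ^+ 2)%:C.
  rewrite (bigD1 i) //= eB eqxx big1 ?addr0 => [|j /negPf ji].
    by rewrite normrZ psi_unit mulr1 -normrX -rmorphXn ger0_norm //
      ler0c exprn_ge0 // ltW.
  by rewrite eB eq_sym ji normr0 expr0n.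
(* The defects [dge0] are nonnegative. As the first column of [A] is contractive, they sum to at
   most [1 - 1], so none is positive. *)
have eqA i : `|A i o psi| ^+ 2 <= \sum_j `|B j o (A i o psi)| ^+ 2.
  rewrite -subr_le0; have dge0 k :
      0 <= `|A k o psi| ^+ 2 - \sum_j `|B j o (A k o psi)| ^+ 2.
    by rewrite subr_ge0 cb.
  apply: le_trans (_ : \sum_k (`|A k o psi| ^+ 2
    - \sum_j `|B j o (A k o psi)| ^+ 2) <= 0).
    by rewrite [leRHS](bigD1 i) //= lerDl sumr_ge0.
  rewrite sumrB subr_le0 (le_trans (ca psi)) // psi_unit expr1n.
  by under eq_bigr do rewrite sumB; rewrite -rmorph_sum /= alpha_sum.
split=> // X MX i j.
rewrite /vector_functional /= adjointPl.
rewrite (column_contraction_polar cb (eqA i)) (bigD1 i) //= [X in _ + X]big1; last first.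
  by move=> k /negPf ki; rewrite eB eq_sym ki inner0r.
rewrite addr0 comm ?eB // eqxx; case: (eqVneq i j) => [<-|_].
  rewrite bopZ innerZl innerZr mul1r mulrA rmorphXn expr2 /=.
  by congr (_ * _ * _); exact: conjc_real.
by rewrite linear0 inner0l !mul0r.
Qed.
End Embezzlement.

(** * Nondegenerate algebras and cyclic subspaces *)

Section NondegenerateAlgebras.
Variables (R : realType) (H : hilbertType R) (M : set (bop H)).
Hypothesis M_vna : von_neumann_algebra M.
Hypothesis M_nondeg : nondegenerate_algebra M.

(** For [x] nonzero, some [y] in [D] would satisfy [|x - y| < |x|], while orthogonality gives
    [|x - y|^2 = |x|^2 + |y|^2]. *)
Lemma dense_orthogonal_eq0 (D : set H) x :
  dense D -> (forall y, D y -> inner x y = 0) -> x = 0.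
Proof.
move=> dD xD; apply/eqP/negPn/negP => x0.
have nx : 0 < `|x| by rewrite normr_gt0.
have [||y []] := dD (ball x `|x|).
- by exists x; exact: ballxx.
- exact: ball_open.
rewrite -ball_normE /= => xy Dy; move: xy.
rewrite -(@ltr_pXn2r _ 2) ?nnegrE // -!inner_norm innerBl !innerBr.
rewrite (innerC y x) (xD y) // rmorph0 subr0 sub0r opprK.
by rewrite gtrDl inner_norm le_gtF // exprn_ge0.
Qed.

(** Since [M] is closed under adjoints, such an [x] is orthogonal to every [X v] with [X] in [M],
    hence to a dense set. *)
Lemma nondegenerate_eq0 x : (forall X, M X -> X x = 0) -> x = 0.
Proof.
move=> Mx; apply: (dense_orthogonal_eq0 M_nondeg) => _ [n [X [v [MX ->]]]].
rewrite inner_sumr big1 // => k _.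
by rewrite -adjointPl Mx ?inner0l //; exact: vna_adjoint.
Qed.

Lemma vna_linear a X Y : M X -> M Y -> M (a *: X + Y).
Proof. by move=> MX MY; apply: vna_add => //; exact: vna_scale. Qed.

Section CyclicSubspace.
Variable psi : H.

(* The closure of [M psi], described as a double orthogonal complement. *)
Definition cyclic_subspace : set H :=
  [set z | forall w, (forall X, M X -> inner (X psi) w = 0) -> inner z w = 0].

Lemma cyclic_subspaceX X : M X -> cyclic_subspace (X psi).
Proof. by move=> MX w; exact. Qed.

Lemma cyclic_subspaceP a x y :
  cyclic_subspace x -> cyclic_subspace y -> cyclic_subspace (a *: x + y).
Proof.
by move=> Kx Ky w w0; rewrite innerDl innerZl Kx // Ky // mulr0 addr0.
Qed.

Lemma cyclic_subspaceB x y :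
  cyclic_subspace x -> cyclic_subspace y -> cyclic_subspace (x - y).
Proof.
by move=> Kx Ky; rewrite addrC -scaleN1r; exact: cyclic_subspaceP.
Qed.

Lemma cyclic_subspaceZ a x : cyclic_subspace x -> cyclic_subspace (a *: x).
Proof. by move=> Kx w w0; rewrite innerZl Kx // mulr0. Qed.

Lemma cyclic_subspaceM X x : M X -> cyclic_subspace x -> cyclic_subspace (X x).
Proof.
move=> MX Kx w w0; rewrite adjointP; apply: Kx => Y MY.
by rewrite -adjointP; apply: (w0 (bop_comp X Y)); exact: vna_mul.
Qed.

(** The difference lies in the double orthogonal complement and is orthogonal to every [X psi],
    hence to itself. *)
Lemma cyclic_subspace_ext x y : cyclic_subspace x -> cyclic_subspace y ->
  (forall X, M X -> inner (X psi) x = inner (X psi) y) -> x = y.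
Proof.
move=> Kx Ky xy; apply/subr0_eq/inner_eq0; apply: cyclic_subspaceB => // X MX.
by rewrite innerBr xy // subrr.
Qed.

Lemma cyclic_representation (f : bop H -> R[i]) (c : R) : 0 <= c ->
  (forall a X Y, f (a *: X + Y) = a * f X + f Y) ->
  (forall X, M X -> `|f X| <= c%:C * `|X psi|) ->
  exists z, [/\ forall X, M X -> f X = inner (X psi) z,
    cyclic_subspace z & `|z| <= c%:C].
Proof.
move=> c0 f_lin f_bound.
exact: (@Riesz _ _ _ M (fun X => X psi) f (vna_0 M_vna) vna_linear).
Qed.

(** Let [z] be the projection of [psi] onto [M psi]. For [Y] in [M], the vector [Y (psi - z)] lies
    in [M psi] and is orthogonal to it, so it vanishes; nondegeneracy then gives [psi = z]. *)
Lemma cyclic_subspace_id : cyclic_subspace psi.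
Proof.
have [c cE] : exists t : R, `|psi| = t%:C.
  by apply/complex_realP; rewrite normr_real.
have c0 : 0 <= c by rewrite -ler0c -cE.
have [||z [zE Kz _]] := @cyclic_representation (fun X => inner (X psi) psi) c c0.
- by move=> a X Y; rewrite innerDl innerZl.
- move=> X MX; rewrite (le_trans (Cauchy_Schwarz_inner _ _)) //.
  by rewrite cE mulrC.
suff -> : psi = z by [].
apply/subr0_eq/nondegenerate_eq0 => Y MY.
apply: cyclic_subspace_ext => [||X MX].
- rewrite linearB /=; apply: cyclic_subspaceB; first exact: cyclic_subspaceX.
  exact: cyclic_subspaceM.
- by move=> w _; rewrite inner0l.
- rewrite inner0r -adjointPl innerBr.
  by rewrite -(zE (bop_comp (adjoint Y) X)) ?subrr //; apply: vna_mul => //;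
    exact: vna_adjoint.
Qed.
End CyclicSubspace.
End NondegenerateAlgebras.

(** * Construction of a column contraction over the commutant *)

Section Intertwiners.
Variables (R : realType) (H : hilbertType R) (M : set (bop H)).
Hypothesis M_vna : von_neumann_algebra M.
Hypothesis M_nondeg : nondegenerate_algebra M.
(** The [a i] stand for the normalised vectors [alpha_i^-1 R_{i0} psi], so that the constants
    [alpha_i] disappear from the orthogonality relations. *)
Variables (d : nat) (psi : H) (a : 'I_d -> H).
Hypothesis a_orth : forall X, M X -> forall i j,
  inner (X (a i)) (a j) = (i == j)%:R * inner (X psi) psi.

Lemma orthogonal_copies X Y i j : M X -> M Y ->
  inner (X (a i)) (Y (a j)) = (i == j)%:R * inner (X psi) (Y psi).
Proof.
move=> MX MY; rewrite -!(adjointPl Y).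
by apply: (a_orth (X := bop_comp (adjoint Y) X)); apply: vna_mul => //;
  exact: vna_adjoint.
Qed.

(* [B] is the adjoint of the partial isometry sending [X psi] to [X (a i)] and
   vanishing on the orthogonal complement of [M psi]. *)
Lemma cyclic_intertwiner i : exists B : bop H,
  (forall y, cyclic_subspace M psi (B y)) /\
  (forall X y, M X -> inner (X psi) (B y) = inner (X (a i)) y).
Proof.
have norm_a X : M X -> `|X (a i)| = `|X psi|.
  move=> MX; apply/eqP; rewrite -(@eqrXn2 _ 2) // -!inner_norm.
  by rewrite orthogonal_copies // eqxx mul1r.
have rep y : exists z, [/\ forall X, M X -> inner (X (a i)) y = inner (X psi) z,
    cyclic_subspace M psi z & `|z| <= `|y|].
  have [c cE] : exists t : R, `|y| = t%:C.
    by apply/complex_realP; rewrite normr_real.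
  have c0 : 0 <= c by rewrite -ler0c -cE.
  rewrite cE; apply: (cyclic_representation M_vna c0).
    by move=> b X Y; rewrite innerDl innerZl.
  move=> X MX; rewrite (le_trans (Cauchy_Schwarz_inner _ _)) //.
  by rewrite norm_a // cE mulrC.
have [g gP] := choice rep.
have gE X y : M X -> inner (X psi) (g y) = inner (X (a i)) y.
  by move=> MX; case: (gP y) => ->.
have Kg y : cyclic_subspace M psi (g y) by case: (gP y).
have [b x y|y|B BE] := @bounded_linear_bop _ _ g 1.
- apply: (@cyclic_subspace_ext _ _ M psi); rewrite ?gE //.
    exact: cyclic_subspaceP.
  move=> X MX; rewrite innerDr innerZr !gE //.
  by rewrite innerDr innerZr.
- by rewrite mul1r; case: (gP y).
- by exists B; split=> [y|X y MX]; rewrite BE ?gE.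
Qed.

Lemma commutant_column : exists b : 'I_d -> bop H,
  [/\ forall i, commutant M (b i), column_contraction b
    & forall i j, b i (a j) = if i == j then psi else 0].
Proof.
have [b bP] := choice cyclic_intertwiner.
have Kb i y : cyclic_subspace M psi (b i y) by case: (bP i).
have bE i X y : M X -> inner (X psi) (b i y) = inner (X (a i)) y.
  by case: (bP i) => _; exact.
have K0 : cyclic_subspace M psi 0 by move=> w _; rewrite inner0l.
exists b; split.
- move=> i Y MY; apply: bop_eqP => y /=.
  apply: (@cyclic_subspace_ext _ _ M psi) => //; first exact: cyclic_subspaceM.
  (* Paired with [X psi], both sides give [<X (a i), Y y>], because [adjoint Y] composed with [X] is
     again in [M]. *)
  move=> X MX; rewrite bE // -[RHS]adjointPl.
  have MYX : M (bop_comp (adjoint Y) X).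
    by apply: vna_mul => //; exact: vna_adjoint.
  by rewrite (bE i (bop_comp (adjoint Y) X)) // -adjointPl.
- move=> y.
  have bX i j X : M X -> b j (X (a i)) = (i == j)%:R *: X psi.
    move=> MX; apply: (@cyclic_subspace_ext _ _ M psi) => //.
      exact/cyclic_subspaceZ/cyclic_subspaceX.
    move=> Y MY; rewrite bE // orthogonal_copies // innerZr eq_sym.
    by case: eqP => _; rewrite ?conjC1 ?conjC0.
  (* The adjoints of the [b i] are thus isometric on [M psi], with mutually orthogonal images. *)
  have bb i j z : cyclic_subspace M psi z ->
      b j (adjoint (b i) z) = (i == j)%:R *: z.
    move=> Kz; apply: (@cyclic_subspace_ext _ _ M psi) => //.
      exact: cyclic_subspaceZ.
    move=> X MX; rewrite bE // -adjointP bX // innerZl innerZr eq_sym.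
    by case: eqP => _; rewrite ?conjC1 ?conjC0.
  (* Bessel's inequality: [u] is the projection of [y] onto the sum of these images, so
     [|y - u|^2 = |y|^2 - n]. *)
  set n := \sum_i _; pose u := \sum_i adjoint (b i) (b i y).
  have uy : inner u y = n.
    by rewrite inner_suml; apply: eq_bigr => i _; rewrite adjointPl inner_norm.
  have uu : inner u u = n.
    rewrite {2}/u inner_sumr; apply: eq_bigr => j _.
    rewrite -adjointP linear_sum (bigD1 j) //= bb // eqxx scale1r big1.
      by rewrite addr0 inner_norm.
    by move=> i /negPf ij; rewrite bb // ij scale0r.
  have yu : inner y u = n.
    rewrite innerC uy; apply/CrealP/ger0_real/sumr_ge0 => i _.
    by rewrite exprn_ge0.
  have := exprn_ge0 2 (normr_ge0 (y - u)).
  by rewrite -inner_norm innerBl !innerBr uy uu yu subrr subr0 subr_ge0 inner_norm.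
- move=> i j; apply: (@cyclic_subspace_ext _ _ M psi) => //.
    by case: eqP => // _; exact: cyclic_subspace_id.
  move=> X MX; rewrite bE // a_orth //.
  by case: eqP => _; rewrite ?mul1r // mul0r inner0r.
Qed.
End Intertwiners.

(** * From monopartite to bipartite embezzlement, and the equivalence *)

Theorem theorem2p9 (R : realType) (H : hilbertType R)
    (d : nat) (hd : (2 <= d)%N) (alpha : 'I_d -> R)
    (alpha_decr : forall i j : 'I_d, (i <= j)%N -> alpha j <= alpha i)
    (alpha_gt0 : forall i : 'I_d, 0 < alpha i)
    (alpha_sum : \sum_(i < d) alpha i ^+ 2 = 1)
    (M : set (bop H)) (M_vna : von_neumann_algebra M)
    (M_nondeg : nondegenerate_algebra M)
    (psi : H) (psi_unit : `|psi| = 1)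
    (A : 'M[bop H]_d) (A_M : matrices_over M A) (A_contr : op_contraction A) :
  monopartite_embezzles hd alpha M A psi <->
  exists B : 'M[bop H]_d,
    [/\ matrices_over (commutant M) B,
        op_contraction B
      & bipartite_embezzles hd alpha M A B psi].
Proof.
split=> [[_ _ _ mono]|[B [_ _ bi]]]; last exact: (monopartite_of_bipartite _ _ _ _ _ bi).
pose o := idx0 hd.
pose a i := (alpha i)%:C^-1 *: A i o psi.
have alphaN0 i : (alpha i)%:C != 0 by rewrite fmorph_eq0 gt_eqF.
have a_orth X : M X -> forall i j,
    inner (X (a i)) (a j) = (i == j)%:R * inner (X psi) psi.
  (* The indices are swapped because the operator under the adjoint ends up in the second argument
     of the inner product. *)
  move=> MX i j; have := mono X MX j i.
  rewrite /vector_functional /= adjointPl /a bopZ innerZl innerZr => ->.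
  rewrite eq_sym; case: eqP => [->|_]; last by rewrite !mul0r !mulr0.
  have -> : ((alpha j)%:C^-1)^*%R = (alpha j)%:C^-1.
    by rewrite fmorphV; congr (_^-1); exact: conjc_real.
  rewrite !mul1r rmorphXn /=; field. exact: alphaN0.
have [b [b_M' cb ba]] := commutant_column M_vna M_nondeg a_orth.
pose B := \matrix_(i, j) if j == o then b i else 0 : bop H.
have B_M' : matrices_over (commutant M) B.
  move=> i j; rewrite mxE; case: eqP => // _ X _.
  by apply: bop_eqP => x /=; rewrite linear0.
have B_contr : op_contraction B by exact: column_op_contraction.
exists B; split=> //; split=> //; apply/bipartite_eqP => i j.
rewrite mxE eqxx.
have -> : A i o (b j psi) = b j (A i o psi).
  by have /(congr1 (fun Z : bop H => Z psi)) /= := b_M' j _ (A_M i o).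
have -> : A i o psi = (alpha i)%:C *: a i by rewrite scalerA divff // scale1r.
by rewrite bopZ ba eq_sym; case: eqP => // _; rewrite scaler0.
Qed.
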